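(* Let $m\geq 2$ be a positive integer and let $p$ be a real number with $2m\leq p<\infty$. Then the constant $C_{\mathbb{C},m,p}^{\mathrm{pol}}$ of the complex polynomial Hardy--Littlewood inequality satisfies \[ C_{\mathbb{C},m,p}^{\mathrm{pol}}\geq 2^{\frac{m}{p}}\quad\text{if } m \text{ is even}, \qquad C_{\mathbb{C},m,p}^{\mathrm{pol}}\geq 2^{\frac{m-1}{p}}\quad\text{if } m \text{ is odd}. \]
   Context: For $n\ge 1$ and $1\le p<\infty$, $\ell_p^n$ denotes $\mathbb{C}^n$ with the norm $\|z\|_p=(\sum_{i=1}^n|z_i|^p)^{1/p}$, and $B_{\ell_p^n}$ is its closed unit ball. For a multi-index $\alpha=(\alpha_1,\ldots,\alpha_n)$ of nonnegative integers, $|\alpha|=\alpha_1+\cdots+\alpha_n$ and $\mathbf{x}^\alpha=x_1^{\alpha_1}\cdots x_n^{\alpha_n}$. A complex $m$-homogeneous polynomial on $\ell_p^n$ has the form $P(x_1,\ldots,x_n)=\sum_{|\alpha|=m}a_\alpha\mathbf{x}^\alpha$ with $a_\alpha\in\mathbb{C}$, and its norm is $\|P\|=\sup_{z\in B_{\ell_p^n}}|P(z)|$. The complex polynomial Hardy--Littlewood inequality (a known result) states that for each integer $m\ge 2$ and each $p$ with $2m\le p\le\infty$ there is a constant $C\ge 1$, not depending on $n$, such that for every $n\ge 1$ and every complex $m$-homogeneous polynomial $P(x_1,\ldots,x_n)=\sum_{|\alpha|=m}a_\alpha\mathbf{x}^\alpha$ on $\ell_p^n$, \[ \left(\sum_{|\alpha|=m}|a_\alpha|^{\frac{2mp}{mp+p-2m}}\right)^{\frac{mp+p-2m}{2mp}}\le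 C\,\|P\|. \] $C_{\mathbb{C},m,p}^{\mathrm{pol}}$ denotes the smallest such constant $C$ (equivalently, a lower bound for $C_{\mathbb{C},m,p}^{\mathrm{pol}}$ is a lower bound for every $C$ for which the inequality holds for all $n$ and all $P$). *)

(* Defs.v *)
From HB Require Import structures.
From mathcomp Require Import all_boot all_order all_algebra.
(* Imported after mathcomp-analysis, [mpoly] fails to load: their notations
   clash. *)
From mathcomp Require Import complex mpoly.
From mathcomp Require Import all_classical all_reals all_analysis.

Set Implicit Arguments.
Unset Strict Implicit.
Unset Printing Implicit Defensive.

Import Order.TTheory GRing.Theory Num.Theory.

Local Open Scope classical_set_scope.
Local Open Scope ring_scope.

(* The norm of [R[i]] takes values in [R[i]]; [cabs] is the same modulus, read
   in [R]. *)
Definition cabs {R : realType} (z : R[i]) : R := ComplexField.Normc.normc z.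

Lemma cabsE (R : realType) (z : R[i]) : `|z| = (cabs z)%:C%C.
Proof. by []. Qed.

Definition lp_norm {R : realType} (p : R) {n : nat} (z : 'I_n -> R[i]) : R :=
  (\sum_(i < n) cabs (z i) `^ p) `^ p^-1.

Definition lp_ball {R : realType} (p : R) (n : nat) : set ('I_n -> R[i]) :=
  [set z | lp_norm p z <= 1].
Arguments lp_ball {R} p n _.

Definition poly_norm {R : realType} (p : R) {n : nat} (P : {mpoly R[i][n]}) : R :=
  sup [set cabs P.@[z] | z in lp_ball p n].

Definition coef_norm {R : realType} (q : R) (m : nat) {n : nat}
    (P : {mpoly R[i][n]}) : R :=
  (\sum_(a : 'X_{1..n < m.+1} | mdeg a == m) cabs P@_a `^ q) `^ q^-1.

Definition HL_exponent {R : realType} (m : nat) (p : R) : R :=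
  (2 * m%:R * p) / (m%:R * p + p - 2 * m%:R).

Definition HL_constant {R : realType} (m : nat) (p C : R) : Prop :=
  1 <= C /\
  forall (n : nat) (P : {mpoly R[i][n]}), (1 <= n)%N -> P \is m.-homog ->
    coef_norm (HL_exponent m p) m P <= C * poly_norm p P.

(* The infimum is taken in [\bar R], so it is [+oo] if no constant is
   admissible; the admissible constants form a closed half-line, so otherwise
   the infimum is the smallest one. *)
Definition C_pol {R : realType} (m : nat) (p : R) : \bar R :=
  ereal_inf [set C%:E | C in [set C : R | HL_constant m p C]].

(* [sup] is only meaningful on bounded nonempty sets. *)
Lemma poly_norm_has_sup (R : realType) (p : R) (n : nat)
    (P : {mpoly R[i][n]}) : 0 < p ->
  has_sup [set cabs P.@[z] | z in lp_ball p n].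
Proof.
move=> p0; have pN0 : p != 0 by rewrite gt_eqF.
have cabs0 : cabs (0 : R[i]) = 0 by exact: ComplexField.Normc.normc0.
have cge0 (x : R[i]) : 0 <= cabs x by rewrite -lecR -cabsE normr_ge0.
have cabsM (x y : R[i]) : cabs (x * y) = cabs x * cabs y.
  exact: ComplexField.Normc.normcM.
split.
  exists (cabs P.@[fun=> 0]).
  exists (fun=> 0) => //=.
  rewrite /lp_ball /= /lp_norm big1 ?powR0 ?invr_eq0 // => i _.
  by rewrite cabs0 powR0.
exists (\sum_(a <- msupp P) cabs P@_a).
move=> _ [z zB <-]; rewrite mevalE.
have z1 i : cabs (z i) <= 1.
  have S1 : \sum_(i < n) cabs (z i) `^ p <= 1.
    have S0 : 0 <= \sum_(i < n) cabs (z i) `^ p.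
      by apply: sumr_ge0 => ? _; exact: powR_ge0.
    rewrite leNgt; apply/negP => S1; move: zB.
    rewrite /lp_ball /= /lp_norm leNgt => /negP; apply.
    by have := @gt0_ltr_powR R p^-1 _ 1 _ _ _ S1; rewrite powR1; apply; rewrite ?invr_gt0 ?nnegrE.
  have : cabs (z i) `^ p <= 1.
    apply: le_trans S1; rewrite (bigD1 i) //= lerDl.
    by apply: sumr_ge0 => ? _; exact: powR_ge0.
  rewrite leNgt => /negP h; rewrite leNgt; apply/negP => z1; apply: h.
  by have := @gt0_ltr_powR R p _ 1 _ _ _ z1; rewrite powR1; apply; rewrite ?nnegrE.
rewrite -lecR -cabsE rmorph_sum /=.
apply: (le_trans (ler_norm_sum _ _ _)); apply: ler_sum => a _.
rewrite normrM -cabsE ler_piMr // normr_prod.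
apply: prodr_ile1 => i _; rewrite normr_ge0 normrX exprn_ile1 //.
by rewrite cabsE -(rmorph1 (real_complex R)) lecR.
Qed.

(* Main.v *)
Require Import Defs.
From mathcomp Require Import all_boot all_order all_algebra.
From mathcomp Require Import complex mpoly.
From mathcomp Require Import all_classical all_reals all_analysis.
From mathcomp Require Import ring lra.

Import Order.TTheory GRing.Theory Num.Theory.

Local Open Scope ring_scope.

(** The lower bound is witnessed by one monomial in two variables,
    x_0 ^ (m - k) x_1 ^ k with k the integer part of m / 2.  Its only
    coefficient is 1, so its coefficient norm is at least 1
    ([coef_norm_monomial_ge1]).  On
    the unit ball of l_p^2 the weights |x_0|^p and |x_1|^p have sum at most 1,
    hence, by the arithmetic-geometric mean inequality, product at most 1/4;
    thus |x_0 x_1| <= 2 ^ (- 2 / p), and since |x_0| <= 1 the monomial is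
    bounded by 2 ^ (- 2 k / p) ([poly_norm_balanced_monomial_le]).  Every
    admissible constant is therefore at least 2 ^ (2 k / p), and 2 k is m or
    m - 1 according to the parity of m. *)

Lemma cabs_ge0 {R : realType} (z : R[i]) : 0 <= cabs z.
Proof. by rewrite -lecR -cabsE normr_ge0. Qed.

Lemma cabsM {R : realType} (z w : R[i]) : cabs (z * w) = cabs z * cabs w.
Proof. exact: ComplexField.Normc.normcM. Qed.

Lemma cabs1 {R : realType} : cabs (1 : R[i]) = 1.
Proof. exact: ComplexField.Normc.normc1. Qed.

Lemma cabsX {R : realType} (z : R[i]) (k : nat) : cabs (z ^+ k) = cabs z ^+ k.
Proof. by elim: k => [|k IHk]; rewrite ?expr0 ?cabs1 // !exprS cabsM IHk. Qed.

Lemma powR_le1 {R : realType} {x r : R} : 0 <= x -> 0 < r ->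
  (x `^ r <= 1) = (x <= 1).
Proof.
move=> x0 r0; have r1 : 1 `^ r = 1 :> R by rewrite powR1.
apply/idP/idP => [|x1].
  rewrite leNgt => xr; rewrite leNgt; apply: contra xr => x1.
  by rewrite -[ltLHS]r1 gt0_ltr_powR ?nnegrE.
by rewrite -[leRHS]r1 ge0_ler_powR ?nnegrE // ltW.
Qed.

Lemma lp_ball_sum_le1 {R : realType} {p : R} {n : nat} {z : 'I_n -> R[i]} :
  0 < p -> lp_ball p n z -> \sum_(i < n) cabs (z i) `^ p <= 1.
Proof.
move=> p0; rewrite /lp_ball /= /lp_norm powR_le1 ?invr_gt0 //.
by apply: sumr_ge0 => i _; exact: powR_ge0.
Qed.

Lemma lp_ball_cabs_le1 {R : realType} {p : R} {n : nat} {z : 'I_n -> R[i]} i :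
  0 < p -> lp_ball p n z -> cabs (z i) <= 1.
Proof.
move=> p0 /(lp_ball_sum_le1 p0) zB.
rewrite -(powR_le1 (cabs_ge0 _) p0); apply: le_trans zB.
by rewrite (bigD1 i) //= lerDl sumr_ge0 // => j _; exact: powR_ge0.
Qed.

(** With u and v the p-th powers of the two moduli, 4 u v <= (u + v)^2 <= 1;
    taking p-th roots gives the bound. *)
Lemma lp_ball2_prod_le {R : realType} {p : R} {z : 'I_2 -> R[i]} :
  0 < p -> lp_ball p 2 z ->
  cabs (z ord0) * cabs (z ord_max) <= 2 `^ (- (2 / p)).
Proof.
move=> p0 /(lp_ball_sum_le1 p0).
rewrite big_ord_recr big_ord1 /=.
rewrite (_ : widen_ord _ _ = ord0); last exact: val_inj.
set a := cabs (z ord0); set b := cabs (z ord_max) => ab1.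
have a0 : 0 <= a by exact: cabs_ge0.
have b0 : 0 <= b by exact: cabs_ge0.
have abp : (a * b) `^ p <= 2 `^ (- 2).
  rewrite powRM // powRN powR_mulrn //.
  have := sqr_ge0 (a `^ p - b `^ p).
  have := powR_ge0 a p; have := powR_ge0 b p; move: ab1.
  set u := a `^ p; set v := b `^ p => uv1 v0 u0 uv.
  nra.
have pN0 : p != 0 by rewrite gt_eqF.
have -> : a * b = (a * b) `^ p `^ p^-1.
  by rewrite -powRrM divff // powRr1 // mulr_ge0.
rewrite -mulNr powRrM.
by apply: ge0_ler_powR; rewrite ?nnegrE ?powR_ge0 ?invr_ge0 ?(ltW p0).
Qed.

Definition balanced_mnm (m : nat) : 'X_{1..2} :=
  [multinom if i == ord0 then uphalf m else m./2 | i < 2].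

Lemma mdeg_balanced (m : nat) : mdeg (balanced_mnm m) = m.
Proof.
rewrite mdegE big_ord_recr big_ord1 !mnmE /= uphalf_half -addnA addnn.
exact: odd_double_half.
Qed.

Lemma poly_norm_balanced_monomial_le {R : realType} {m : nat} {p : R} :
  0 < p ->
  poly_norm p ('X_[balanced_mnm m] : {mpoly R[i][2]})
    <= 2 `^ (- ((m./2).*2%:R / p)).
Proof.
move=> p0; apply: ge_sup.
  by have [] := poly_norm_has_sup ('X_[balanced_mnm m] : {mpoly R[i][2]}) p0.
move=> _ [z zB <-].
rewrite mevalX.
rewrite big_ord_recr big_ord1 /= !mnmE /=.
rewrite (_ : widen_ord _ _ = ord0); last exact: val_inj.
rewrite cabsM !cabsX uphalf_half exprD -mulrA -exprMn.
have -> : (2 : R) `^ (- ((m./2).*2%:R / p)) = (2 `^ (- (2 / p))) ^+ m./2.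
  by rewrite -powR_mulrn ?powR_ge0 // -powRrM -muln2 natrM; congr (_ `^ _); ring.
rewrite -[leRHS]mul1r; apply: ler_pM.
- by rewrite exprn_ge0 ?cabs_ge0.
- by rewrite exprn_ge0 ?mulr_ge0 ?cabs_ge0.
- by rewrite exprn_ile1 ?cabs_ge0 ?(lp_ball_cabs_le1 _ p0 zB).
- by rewrite lerXn2r ?nnegrE ?mulr_ge0 ?cabs_ge0 ?powR_ge0 ?lp_ball2_prod_le.
Qed.

Lemma coef_norm_monomial_ge1 {R : realType} {q : R} {m n : nat}
    {a : 'X_{1..n}} : 0 <= q -> mdeg a = m ->
  1 <= coef_norm q m ('X_[a] : {mpoly R[i][n]}).
Proof.
move=> q0 am; have am1 : (mdeg a < m.+1)%N by rewrite am.
have q1 : 1 `^ q^-1 = 1 :> R by rewrite powR1.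
rewrite /coef_norm -[leLHS]q1.
have S1 : 1 <= \sum_(b : 'X_{1..n < m.+1} | mdeg b == m)
    cabs ('X_[a] : {mpoly R[i][n]})@_b `^ q.
  rewrite (bigD1 (BMultinom am1)) /=; last by rewrite am.
  rewrite mcoeffX eqxx cabs1 powR1 lerDl.
  by apply: sumr_ge0 => b _; exact: powR_ge0.
by apply: ge0_ler_powR; rewrite ?invr_ge0 ?nnegrE // (le_trans _ S1).
Qed.

Lemma HL_exponent_ge0 {R : realType} {m : nat} {p : R} :
  2 * m%:R <= p -> 0 <= HL_exponent m p.
Proof.
move=> hp; have m0 : 0 <= m%:R :> R by [].
have p0 : 0 <= p by lra.
by rewrite /HL_exponent divr_ge0 ?mulr_ge0 // -addrA addr_ge0 ?mulr_ge0 // subr_ge0.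
Qed.

Lemma HL_constant_ge {R : realType} {m : nat} {p C : R} :
  0 < p -> 2 * m%:R <= p -> HL_constant m p C ->
  2 `^ ((m./2).*2%:R / p) <= C.
Proof.
move=> p0 hp [C1 /(_ 2%N 'X_[balanced_mnm m] isT) HC].
have Phom : ('X_[balanced_mnm m] : {mpoly R[i][2]}) \is m.-homog.
  by rewrite dhomogX; apply/eqP; exact: mdeg_balanced.
have C0 : 0 <= C by lra.
have := coef_norm_monomial_ge1 (HL_exponent_ge0 hp) (mdeg_balanced m).
move=> /le_trans /(_ (HC Phom)) /le_trans.
move=> /(_ _ (ler_wpM2l C0 (poly_norm_balanced_monomial_le p0))).
by rewrite powRN ler_pdivlMr ?powR_gt0 // mul1r.
Qed.

Lemma C_pol_ge {R : realType} {m : nat} {p : R} : 0 < p -> 2 * m%:R <= p ->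
  ((2 `^ ((m./2).*2%:R / p))%:E <= C_pol m p)%E.
Proof.
move=> p0 hp; apply: le_ereal_inf_tmp => _ [C HC <-].
by rewrite lee_fin; exact: HL_constant_ge.
Qed.

Theorem theorem2p2 (R : realType) (m : nat) (p : R)
    (hm : (2 <= m)%N) (hp : 2 * m%:R <= p) :
  (~~ odd m -> ((2 `^ (m%:R / p))%:E <= C_pol m p)%E) /\
  (odd m -> ((2 `^ ((m%:R - 1) / p))%:E <= C_pol m p)%E).
Proof.
have p0 : 0 < p.
  by apply: lt_le_trans hp; rewrite mulr_gt0 // ltr0n (leq_trans _ hm).
have := C_pol_ge p0 hp; have := odd_double_half m.
case: (odd m) => mE hC; split => // _.
- by rewrite -[in (m%:R - 1)]mE natrD addrC addKr.
- by rewrite -[in (m%:R / p)]mE.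
Qed.
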